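(* Let $p$ be a prime, $r\ge 1$ and $q=p^r$. Let $\beta\in VB_k$ be a $k$-strand virtual braid that admits an Alexander numbering, and suppose that $K=\widehat{\beta^{q}}$ is a ($q$-periodic, almost classical) knot diagram. Then its quotient is $K_*=\widehat{\beta}$, and (1) $\Delta_{K_*}(t)$ divides $\Delta_K(t)$ in $\mathbb{Z}[t^{\pm1}]$; (2) $\Delta_K(t)\doteq\left(\Delta_{K_*}(t)\right)^{q}\left(f(t)\right)^{q-1} \bmod p$, where $f(t)=\sum_{i=1}^{k}t^{\lambda_i}$ and $\lambda_i$ is the Alexander number on the $i$-th strand at the top of $\beta$. Here $\doteq$ means equality up to multiplication by $\pm t^m$ for some $m\in\mathbb{Z}$.
   Context: Virtual knot diagrams: immersed oriented circles in the plane with double points marked classical (over/under) or virtual. A diagram is $q$-periodic if it misses the origin and is invariant under rotation by $2\pi/q$ about the origin; its quotient $K_*$ is the diagram obtained by taking one fundamental domain (a sector of angle $2\pi/q$) and joining the corresponding endpoints on its two edges by concentric circular arcs. $VB_k$ is the virtual braid group with generators $\sigma_i$ (classical crossing of strands $i,i+1$) and $\tau_i$ (virtual crossing of strands $i,i+1$), $1\le i\le k-1$; braids are drawn from top to bottom with strands oriented downwards, and $\widehat\beta$ denotes the closure of $\beta$. Alexander numberings: short arcs of a diagram are the arcs between consecutive classical crossing points (passing over, under; virtual crossings are ignored). An Alexander numbering is an integer-valued function on short arcs such that at each classical crossing there is an integer $\lambda$ with: at a positive (right-handed) crossing, the incoming under-arc and outgoing over-arc have number $\lambda$ and the outgoing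 under-arc and incoming over-arc have number $\lambda+1$; at a negative (left-handed) crossing, the incoming over-arc and outgoing under-arc have number $\lambda$ and the outgoing over-arc and incoming under-arc have number $\lambda+1$. Numbers do not change along a strand passing a virtual crossing. (Equivalently, for a crossing with both strands oriented downwards, the two left-hand arcs have number $\lambda$ and the two right-hand arcs have number $\lambda+1$.) A diagram is almost classical if it admits an Alexander numbering. A virtual braid admits an Alexander numbering (is almost classical) if its arcs can be so numbered with the numbers along the bottom agreeing, position by position, with those along the top. Alexander polynomial: for a knot diagram with $n$ classical crossings, label the arcs running from one undercrossing to the next $x_1,\dots,x_n$ consecutively, so that at the $i$-th crossing (of sign $\varepsilon_i$) $x_i$ is the incoming under-arc, $x_{i+1}$ (indices mod $n$) the outgoing under-arc, and $x_{k(i)}$ the over-arc. The knot group is $G_K=\langle x_1,\dots,x_n\mid x_{i+1}=x_{k(i)}^{-\varepsilon_i}x_ix_{k(i)}^{\varepsilon_i}\rangle$, and $A$ is the $n\times n$ matrix over $\mathbb{Z}[t^{\pm1}]$ whose $i$-th row is the sum of $t^{-\varepsilon_i}$ in column $i$, $-1$ in column $i+1$, and $1-t^{-\varepsilon_i}$ in column $k(i)$ (the Fox Jacobian evaluated at all $x_j=t$). For almost classical knots the ideal generated by the $(n-1)\times(n-1)$ minors of $A$ is principal, and $\Delta_K(t)$ is a generator (well defined up to $\pm t^m$; equal to $1$ if $n=0$). *)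

(* Defs.v *)
From HB Require Import structures.
From mathcomp Require Import all_boot all_fingroup all_algebra.
From mathcomp Require Import boolp.

Set Implicit Arguments.
Unset Strict Implicit.
Unset Printing Implicit Defensive.

Import GRing.Theory.
Local Open Scope ring_scope.

(** * Laurent polynomials

    Z[t, t^-1], realized as the subring of the fraction field Q(t) of Z[t]
    consisting of the fractions whose denominator is a power of t. *)

Definition tfrac : {fraction {poly int}} := tofrac 'X.

Definition laurent_pred : {pred {fraction {poly int}}} := fun x =>
  `[< exists (f : {poly int}) (m : nat), x = tofrac f / tfrac ^+ m >].

Lemma tfrac_neq0 : tfrac != 0.
Proof. by rewrite /tfrac tofrac_eq0 polyX_eq0. Qed.

Lemma laurent_subring_closed : subring_closed laurent_pred.
Proof.
have t0 n : tfrac ^+ n != 0 by rewrite expf_neq0 ?tfrac_neq0.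
split=> [|_ _ /asboolP[f [m ->]] /asboolP[g [n ->]]
         |_ _ /asboolP[f [m ->]] /asboolP[g [n ->]]]; apply/asboolP.
- by exists 1, 0%N; rewrite rmorph1 expr0 divr1.
- exists (f * 'X^n - g * 'X^m), (m + n)%N.
  rewrite rmorphB !rmorphM !rmorphXn /= -/tfrac exprD mulrBl.
  by rewrite -mulf_div divff // mulr1 [tfrac ^+ m * _]mulrC -mulf_div divff // mulr1.
- by exists (f * g), (m + n)%N; rewrite rmorphM mulf_div exprD.
Qed.

HB.instance Definition _ :=
  GRing.isSubringClosed.Build {fraction {poly int}} laurent_pred
    laurent_subring_closed.

Record laurent := Laurent {
  laurent_val :> {fraction {poly int}};
  _ : laurent_val \in laurent_pred }.

HB.instance Definition _ := [isSub for laurent_val].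
HB.instance Definition _ := [Choice of laurent by <:].
HB.instance Definition _ := [SubChoice_isSubComNzRing of laurent by <:].

Lemma laurent_mon_subproof (m : int) : tfrac ^ m \in laurent_pred.
Proof.
apply/asboolP; case: m => m.
  by exists 'X^m, 0%N; rewrite rmorphXn expr0 divr1.
by exists 1, m.+1; rewrite rmorph1 div1r.
Qed.

Definition tpow (m : int) : laurent := Laurent (laurent_mon_subproof m).

Definition ldvd (a b : laurent) : Prop := exists c : laurent, b = c * a.

Definition doteq (a b : laurent) : Prop :=
  exists (e : bool) (m : int), a = (-1) ^+ e * tpow m * b.

Definition doteq_mod (p : nat) (a b : laurent) : Prop :=
  exists (e : bool) (m : int) (c : laurent),
    a = (-1) ^+ e * tpow m * b + p%:R * c.

(** * Virtual link diagrams

    The oriented circles of the diagram are cut into finitely many edges, and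
    [step e] is the edge following [e] along the orientation.  The strand
    leaving [e] for [step e] goes over the classical crossing [c] if
    [e = over_in c], under [c] if [e = under_in c], and otherwise merely passes
    a virtual crossing or a subdivision point.  Hence the outgoing arcs at [c]
    start with [step (over_in c)] and [step (under_in c)].  A component without
    classical crossing is a cycle of edges none of which is of the form
    [over_in c] or [under_in c]. *)

Record vdiagram := VDiagram {
  edge : finType;
  step : edge -> edge;
  crossing : finType;
  positive : crossing -> bool;
  over_in : crossing -> edge;
  under_in : crossing -> edge;
  step_inj : injective step;
  over_in_inj : injective over_in;
  under_in_inj : injective under_in;
  over_under_neq : forall c d, over_in c != under_in d }.

Definition is_knot (D : vdiagram) : Prop :=
  (0 < #|edge D|)%N /\ forall e e' : edge D, fconnect (@step D) e e'.

Definition alexander_numbering (D : vdiagram) (a : edge D -> int) : Prop :=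
  (forall e : edge D,
      e \notin codom (@over_in D) -> e \notin codom (@under_in D) ->
      a (step e) = a e) /\
  (forall c : crossing D, exists l : int,
      if positive c then
        [/\ a (under_in c) = l, a (step (over_in c)) = l,
            a (step (under_in c)) = l + 1 & a (over_in c) = l + 1]
      else
        [/\ a (over_in c) = l, a (step (under_in c)) = l,
            a (step (over_in c)) = l + 1 & a (under_in c) = l + 1]).

Definition almost_classical (D : vdiagram) : Prop :=
  exists a : edge D -> int, alexander_numbering a.

(** * Alexander polynomial

    An arc running from one undercrossing to the next is named after the
    crossing at which it ends: this is the labelling in which [x_c] is the
    incoming under-arc at [c].  [in_arc c e] says that [e] lies on [x_c], i.e.
    that following the strand from [e] one reaches [under_in c] without going
    through an undercrossing before. *)

Definition in_arc (D : vdiagram) (c : crossing D) (e : edge D) : bool :=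
  connect [rel x y | (x \notin codom (@under_in D)) && (y == step x)]
    e (under_in c).

Definition csign (D : vdiagram) (c : crossing D) : int :=
  if positive c then 1 else -1.

Definition alexander_matrix (D : vdiagram) : 'M[laurent]_#|crossing D| :=
  \matrix_(i, j)
    let c := enum_val i in let d := enum_val j in
    tpow (- csign c) * (in_arc d (under_in c))%:R
    - (in_arc d (step (under_in c)))%:R
    + (1 - tpow (- csign c)) * (in_arc d (over_in c))%:R.

Definition in_minor_ideal (n : nat) (A : 'M[laurent]_n) (x : laurent) : Prop :=
  exists c : 'M[laurent]_n,
    x = \sum_i \sum_j c i j * \det (row' i (col' j A)).

(** The case distinction is needed because [row'] and [col'] produce no minor
    at all from a 0 x 0 matrix. *)
Definition is_alexander_polynomial (D : vdiagram) (Delta : laurent) : Prop :=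
  if #|crossing D| == 0%N then doteq Delta 1
  else forall x : laurent,
    in_minor_ideal (alexander_matrix D) x <-> ldvd Delta x.

(** * Virtual braids

    A braid on [k] strands is a word read from top to bottom; a letter
    [(kind, i)] is a crossing of the strands at positions [i] and [i + 1]
    (counted from 0), which is virtual if [kind = None] and classical of sign
    [e] if [kind = Some e] ([true] for positive).  With both strands oriented
    downwards, the over-strand of a positive crossing comes in from the right,
    and that of a negative crossing from the left.
    Which of the two signs is called [sigma] is a convention without effect, as
    words contain both the generators and their inverses. *)

Definition letter (k : nat) : Type := (option bool * 'I_k.-1)%type.

Definition sigma (k : nat) (i : 'I_k.-1) : letter k := (Some true, i).
Definition sigma_inv (k : nat) (i : 'I_k.-1) : letter k := (Some false, i).
Definition tau (k : nat) (i : 'I_k.-1) : letter k := (None, i).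

Definition vbraid (k : nat) : Type := seq (letter k).

Definition vbraid_pow (k : nat) (w : vbraid k) (q : nat) : vbraid k :=
  flatten (nseq q w).

Lemma lpos_subproof (k : nat) (i : 'I_k.-1) : (i < k)%N.
Proof. exact: leq_trans (ltn_ord i) (leq_pred k). Qed.

Lemma rpos_subproof (k : nat) (i : 'I_k.-1) : (i.+1 < k)%N.
Proof. by case: k i => [[]|k i] //=; rewrite ltnS. Qed.

Definition lpos (k : nat) (i : 'I_k.-1) : 'I_k := Ordinal (lpos_subproof i).
Definition rpos (k : nat) (i : 'I_k.-1) : 'I_k := Ordinal (rpos_subproof i).

(** A closed braid is drawn around the origin: the letters of its word sit at
    equally spaced angles and are joined by arcs of [k] concentric circles. *)

Record closed_braid (k : nat) := Closure { word : vbraid k }.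

(** The edges of the closure of a word of length [n] are the strand pieces
    [(s, j)] at position [j] between the letters [s - 1] and [s], where
    [0 <= s <= n].  The piece [(n, j)] at the bottom is followed by [(0, j)]. *)

Section ClosureDiagram.
Variables (k : nat) (w : vbraid k).

Definition cb_edge : finType := ('I_(size w).+1 * 'I_k)%type.

Definition level_perm (s : nat) : {perm 'I_k} :=
  if onth w s is Some g then tperm (lpos g.2) (rpos g.2) else 1%g.

Definition cb_step (e : cb_edge) : cb_edge := (ordS e.1, level_perm e.1 e.2).

(** [((s, b), i)] : the letter [s] of [w] is a classical crossing of sign [b]
    at position [i]. *)
Definition cb_crossing : finType :=
  {c : 'I_(size w).+1 * bool * 'I_k.-1 |
    onth w c.1.1 == Some (Some c.1.2, c.2)}.

Definition cb_positive (c : cb_crossing) : bool := (val c).1.2.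

Definition cb_over_in (c : cb_crossing) : cb_edge :=
  ((val c).1.1, if cb_positive c then rpos (val c).2 else lpos (val c).2).

Definition cb_under_in (c : cb_crossing) : cb_edge :=
  ((val c).1.1, if cb_positive c then lpos (val c).2 else rpos (val c).2).

Lemma cb_step_inj : injective cb_step.
Proof.
case=> [s i] [s' i'] /= eq_e; have /ordS_inj ss := congr1 fst eq_e.
rewrite /= in ss; subst s'.
by have /perm_inj /= -> := congr1 snd eq_e.
Qed.

Lemma cb_crossing_inj (c d : cb_crossing) : (val c).1.1 = (val d).1.1 -> c = d.
Proof.
case: c d => [[[s b] i] /= Hc] [[[s' b'] i'] /= Hd] /= ss; apply: val_inj => /=.
by move: Hd; rewrite -ss (eqP Hc) => /eqP[-> ->].
Qed.

Lemma cb_over_in_inj : injective cb_over_in.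
Proof. by move=> c d /(congr1 fst)/cb_crossing_inj. Qed.

Lemma cb_under_in_inj : injective cb_under_in.
Proof. by move=> c d /(congr1 fst)/cb_crossing_inj. Qed.

Lemma cb_over_under_neq c d : cb_over_in c != cb_under_in d.
Proof.
apply/eqP=> eq_cd; have := congr1 fst eq_cd => /cb_crossing_inj cd.
move: eq_cd; rewrite -{}cd => /(congr1 (fun e : cb_edge => val e.2)) /=.
by case: (cb_positive c) => /= /eqP; rewrite ?(gtn_eqF (ltnSn _)) ?(ltn_eqF (ltnSn _)).
Qed.

Definition cb_diagram : vdiagram :=
  VDiagram cb_positive cb_step_inj cb_over_in_inj cb_under_in_inj
    cb_over_under_neq.

End ClosureDiagram.

Definition diagram_of (k : nat) (K : closed_braid k) : vdiagram :=
  cb_diagram (word K).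
Coercion diagram_of : closed_braid >-> vdiagram.

(** [lam s j] is the number of the piece [(s, j)] of the braid [w].  Going
    through the closing arcs, the numbering condition says that the numbers at
    the bottom agree with those at the top. *)
Definition braid_numbering (k : nat) (w : vbraid k)
    (lam : 'I_(size w).+1 -> 'I_k -> int) : Prop :=
  @alexander_numbering (Closure w) (fun e : cb_edge w => lam e.1 e.2).

(** * Periodicity

    Rotating a closed braid with [n] letters about the origin by [2 pi / q]
    shifts its letters by [n / q] places. *)

Definition periodic (k q : nat) (K : closed_braid k) : Prop :=
  (q %| size (word K))%N /\ rot (size (word K) %/ q) (word K) = word K.

(** A sector of angle [2 pi / q] contains the first [n / q] letters, and
    joining its two edges by concentric circular arcs closes up that braid. *)
Definition quotient_diagram (k q : nat) (K : closed_braid k) : closed_braid k :=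
  Closure (take (size (word K) %/ q) (word K)).

(* Main.v *)
(** In Alexander-numbered diagrams the Wirtinger relations between the labels of
    the edges form a square matrix [M] with [M 1 = 0] and [w M = 0], where the
    entries of [w] are powers of [t] read off the numbering; hence
    [\adj M = c (1 w)] for a scalar [c].  Eliminating all edges but those entering
    an undercrossing turns [M] into the Alexander matrix, so [c] generates the
    ideal of its minors and is the Alexander polynomial.  Eliminating instead all
    edges but those at the top of the braid turns [M] into [B - 1], where [B] is
    the Burau-type matrix of [beta], so that [\adj (B - 1) = c (1 w)] up to a
    unit, with [w = (t^lam_1, ..., t^lam_k)].

    The braid [beta^q] has the matrix [B^q].  From
    [B^q - 1 = (B - 1) (1 + B + ... + B^(q-1))] and multiplicativity of the
    adjugate, [c] divides the scalar [c'] belonging to [beta^q].  Modulo [p],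
    [B^q - 1 = (B - 1)^q], hence [c' (1 w) = (c (1 w))^q = c^q f^(q-1) (1 w)],
    as [w 1 = f]. *)

Require Import Defs.
From mathcomp Require Import all_boot all_fingroup all_algebra.
From mathcomp Require Import ring.
From mathcomp Require Import boolp.

Set Implicit Arguments.
Unset Strict Implicit.
Unset Printing Implicit Defensive.

Import GRing.Theory.
Local Open Scope ring_scope.

(** * Determinants and matrices of corank one *)

Section Matrices.
Variable R : comNzRingType.
Implicit Types (m n : nat).

(** With [rank] decreasing along the nonzero entries that are not in position
    [(i, s i)], no permutation but [s] contributes to the Leibniz formula. *)
Lemma det_ranked n (F : 'M[R]_n) (s : 'S_n) (rank : 'I_n -> nat) :
    (forall i j, F i j != 0 -> j = s i \/ (rank j < rank (s i))%N) ->
  \det F = (-1) ^+ s * \prod_i F i (s i).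
Proof.
move=> F_rank; rewrite /determinant (bigD1 s) //= [X in _ + X]big1 ?addr0 // => u neq_us.
suff /existsP[i /eqP Fi0]: [exists i, F i (u i) == 0].
  by rewrite (bigD1 i) //= Fi0 mul0r mulr0.
apply: contraNT neq_us; rewrite negb_exists => /forallP Fn0.
have le_rank i : (rank (u i) <= rank (s i) ?= iff (u i == s i))%N.
  split; first by case: (F_rank _ _ (Fn0 i)) => [-> //|/ltnW].
  case: (F_rank _ _ (Fn0 i)) => [-> |lt_us]; first by rewrite !eqxx.
  by rewrite ltn_eqF //; apply/esym/eqP => eq_us; rewrite eq_us ltnn in lt_us.
have [_] := leqif_sum (P := xpredT) (fun i _ => le_rank i).
have sum_perm (v : 'S_n) : (\sum_i rank (v i) = \sum_i rank i)%N.
  by rewrite [RHS](reindex_inj (@perm_inj _ v)).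
rewrite !sum_perm eqxx => /esym/forallP eq_us.
by apply/eqP/permP => i; apply/eqP/(implyP (eq_us i)).
Qed.

(** Sylvester's identity: multiplying the block matrix with rows [(1, X)] and [(Y, 1)] by one and
    the same unipotent matrix, from the right or from the left, makes it block triangular with the
    one or the other side as determinant. *)
Lemma det_one_sub_mul m n (X : 'M[R]_(m, n)) (Y : 'M[R]_(n, m)) :
  \det (1%:M - X *m Y) = \det (1%:M - Y *m X).
Proof.
have eqR : block_mx 1%:M X Y 1%:M *m block_mx 1%:M 0 (- Y) 1%:M
    = block_mx (1%:M - X *m Y) X 0 1%:M.
  by rewrite mulmx_block !mulmx1 !mul1mx !mulmxN !mulmx0 !add0r subrr.
have eqL : block_mx 1%:M 0 (- Y) 1%:M *m block_mx 1%:M X Y 1%:M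
    = block_mx 1%:M X 0 (1%:M - Y *m X).
  rewrite mulmx_block !mulmx1 !mul1mx !mulNmx !mul0mx !addr0.
  by rewrite addNr [- _ + _]addrC.
move: (congr1 determinant eqR) (congr1 determinant eqL).
by rewrite !det_mulmx !det_ublock !det_lblock !det1 !mul1r !mulr1 => -> ->.
Qed.

(** Gaussian elimination: [G] is solved by [J] for prescribed values on the
    rows [v], and [M] differs from [G] in these rows only. *)
Lemma det_elim m n (M G : 'M[R]_m) (J : 'M[R]_(m, n)) (v : 'I_n -> 'I_m) :
    injective v ->
    (forall i, i \notin codom v -> row i M = row i G) ->
    (forall i j, (G *m J) i j = (i == v j)%:R) ->
  \det M = \det G * \det (rowsub v (M *m J)).
Proof.
move=> v_inj M_G GJ.
pose H : 'M_(n, m) := rowsub v G - rowsub v M.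
(* Multiplication by [G *m J] puts row [l] of [H] at position [v l], so the product exchanges
   exactly the rows [v] of [G] for those of [M]. Sylvester's identity then brings the second factor
   down to size [n]. *)
have M_E : M = G *m (1%:M - J *m H).
  have GJH i j : (G *m J *m H) i j
      = \sum_l (i == v l)%:R * (G (v l) j - M (v l) j).
    by rewrite mxE; apply: eq_bigr => l _; rewrite GJ !mxE.
  rewrite mulmxBr mulmx1 mulmxA; apply/matrixP => i j.
  rewrite [RHS]mxE [X in _ + X]mxE GJH.
  have [/codomP[l ->]|i_v] := boolP (i \in codom v).
    rewrite (bigD1 l) //= eqxx mul1r big1 => [|l' ll']; first by ring.
    by rewrite (inj_eq v_inj) eq_sym (negPf ll') mul0r.
  rewrite big1 => [|l _]; last first.
    by case: eqP i_v => [->|]; rewrite ?codom_f ?mul0r.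
  by have /rowP/(_ j) := M_G i i_v; rewrite !mxE => ->; ring.
rewrite {1}M_E det_mulmx det_one_sub_mul mulmxBl !mul_rowsub_mx.
congr (_ * \det _).
have ->: G *m J = \matrix_(i, j) (i == v j)%:R by apply/matrixP=> i j; rewrite GJ mxE.
by apply/matrixP => i j; rewrite !mxE (inj_eq v_inj); ring.
Qed.

(** With a unit vector as the new row, an entry of the adjugate becomes a determinant of full size,
    to which [det_elim] applies. *)
Definition replace_row m n (M : 'M[R]_(m, n)) (i : 'I_m) (r : 'rV[R]_n) :
    'M[R]_(m, n) :=
  \matrix_(a, b) if a == i then r 0 b else M a b.

Lemma mul_replace_row m n l (M : 'M[R]_(m, n)) i r (Y : 'M[R]_(n, l)) :
  replace_row M i r *m Y = replace_row (M *m Y) i (r *m Y).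
Proof.
apply/matrixP => a b; rewrite !mxE; case: ifP => ai.
  by apply: eq_bigr => j _; rewrite mxE ai.
by apply: eq_bigr => j _; rewrite mxE ai.
Qed.

Lemma rowsub_replace_row m n l (M : 'M[R]_(m, n)) (v : 'I_l -> 'I_m) i r :
  injective v -> rowsub v (replace_row M (v i) r) = replace_row (rowsub v M) i r.
Proof. by move=> v_inj; apply/matrixP => a b; rewrite !mxE (inj_eq v_inj). Qed.

Lemma cofactor_replace_row m (M : 'M[R]_m) i r j :
  cofactor (replace_row M i r) i j = cofactor M i j.
Proof.
rewrite /cofactor; congr (_ * \det _); apply/matrixP=> a b.
by rewrite !mxE eq_sym (negPf (neq_lift _ _)).
Qed.

Lemma det_replace_row m (M : 'M[R]_m) i r :
  \det (replace_row M i r) = (r *m \adj M) 0 i.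
Proof.
rewrite (expand_det_row _ i) mxE; apply: eq_bigr => j _.
by rewrite cofactor_replace_row !mxE eqxx.
Qed.

Lemma det_replace_row_delta m (M : 'M[R]_m) i j :
  \det (replace_row M i (delta_mx 0 j)) = (\adj M) j i.
Proof. by rewrite det_replace_row -rowE mxE. Qed.

Lemma tr_adj m (M : 'M[R]_m) : (\adj M)^T = \adj (M^T).
Proof. by apply/matrixP => i j; rewrite !mxE cofactor_tr. Qed.

(** Cramer's rule: once row [i] of [M] is the unit vector at [l], the vector [u] is sent to [u l 0]
    times the unit vector at [i], while the cofactors along row [i] are unchanged. *)
Lemma adj_right_null m (M : 'M[R]_m) (u : 'cV[R]_m) i j l :
  M *m u = 0 -> (\adj M) j i * u l 0 = (\adj M) l i * u j 0.
Proof.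
move=> Mu0; pose N := replace_row M i (delta_mx 0 l).
have Nu : N *m u = u l 0 *: delta_mx i 0.
  apply/colP => a; rewrite !mxE.
  have [->|ai] := eqVneq a i.
    rewrite (bigD1 l) //= !mxE !eqxx mul1r mulr1 big1 ?addr0 // => b bl.
    by rewrite !mxE eqxx (negPf bl) mul0r.
  rewrite mulr0; have /colP/(_ a) := Mu0; rewrite !mxE => {2}<-.
  by apply: eq_bigr => b _; rewrite !mxE (negPf ai).
have := congr1 (mulmx (\adj N)) Nu.
rewrite mulmxA mul_adj_mx -scalemxAr -colE => /colP/(_ j).
rewrite mul_scalar_mx !mxE cofactor_replace_row det_replace_row_delta !mxE.
by move=> ->; rewrite mulrC.
Qed.

(** The null column makes all rows of the adjugate equal, and the null row makes them proportional
    to [w]. The unit entry [w 0 i0] extracts the factor without any division in [R]. *)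
Lemma adj_corank1 m (M : 'M[R]_m) (w : 'rV[R]_m) (i0 : 'I_m) (v : R) :
    M *m const_mx 1 = 0 :> 'cV_m -> w *m M = 0 -> w 0 i0 * v = 1 ->
  exists c, \adj M = c *: (const_mx 1 *m w).
Proof.
move=> Mu0 wM0 wv; exists (v * (\adj M) i0 i0); apply/matrixP => j i.
have cst l : (\adj M) j l = (\adj M) i0 l.
  by have := @adj_right_null _ M (const_mx 1) l j i0 Mu0; rewrite !mxE !mulr1.
have MTw : M^T *m w^T = 0 by rewrite -trmx_mul wM0 trmx0.
have := adj_right_null i0 i i0 MTw; rewrite -!tr_adj [w^T i0 0]mxE [w^T i 0]mxE.
rewrite ![(_^T) _ _]mxE => /(congr1 (fun x => x * v)).
rewrite -mulrA wv mulr1 cst => ->.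
rewrite [RHS]mxE [X in _ = _ * X]mxE big_ord1 [const_mx _ _ _]mxE; ring.
Qed.

End Matrices.

(** * Multiplicativity and congruences of adjugates; binomials modulo a prime *)

Section Adjugates.
Variable R : comNzRingType.

Lemma map_horner_polyC n (z : R) (X : 'M[R]_n) :
  map_mx (horner_eval z) (map_mx polyC X) = X.
Proof. by apply/matrixP => i j; rewrite !mxE /horner_eval hornerC. Qed.

(** Adding ['X%:M] makes the determinants regular. *)
Lemma adj_mulmx n (X Y : 'M[R]_n) : \adj (X *m Y) = \adj Y *m \adj X.
Proof.
pose shift (Z : 'M[R]_n) : 'M[{poly R}]_n := 'X%:M + map_mx polyC Z.
have eval_shift Z : map_mx (horner_eval 0) (shift Z) = Z.
  rewrite map_mxD map_horner_polyC map_scalar_mx.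
  by rewrite /= /horner_eval hornerX raddf0 add0r.
(* This determinant is the characteristic polynomial of [- Z], hence monic. *)
have shift_reg Z : GRing.lreg (\det (shift Z)).
  rewrite /shift -[Z]opprK map_mxN; apply/monic_lreg.
  exact: char_poly_monic.
suff eq_adj: \adj (shift X *m shift Y) = \adj (shift Y) *m \adj (shift X).
  have := congr1 (map_mx (horner_eval 0)) eq_adj.
  by rewrite !(map_mx_adj, map_mxM) !eval_shift.
have : \adj (shift X *m shift Y) *m (shift X *m shift Y)
    *m (\adj (shift Y) *m \adj (shift X))
    = \det (shift X *m shift Y) *: (\adj (shift Y) *m \adj (shift X)).
  by rewrite mul_adj_mx mul_scalar_mx.
rewrite -!mulmxA [shift Y *m (_ *m _)]mulmxA mul_mx_adj mul_scalar_mx.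
rewrite -scalemxAr mul_mx_adj -scalemxAr mul_mx_scalar scalerA det_mulmx mulrC.
move=> /matrixP eq_det; apply/matrixP => i j; have := eq_det i j.
rewrite mxE [RHS]mxE -!mulrA => /shift_reg; exact: shift_reg.
Qed.

Lemma horner_congr0 (P : {poly R}) (z : R) : exists d, P.[z] = P.[0] + z * d.
Proof.
elim/poly_ind: P => [|P c _]; first by exists 0; rewrite !horner0 mulr0 addr0.
by exists P.[z]; rewrite !hornerE; ring.
Qed.

(** Entries of the adjugate are polynomials in the entries of the matrix: with an indeterminate in
    place of [z], the values at [z] and at 0 agree modulo [z]. *)
Lemma adj_congr n (z : R) (X C : 'M[R]_n) i j :
  exists d, (\adj (X + z *: C)) i j = (\adj X) i j + z * d.
Proof.
pose P : 'M[{poly R}]_n := map_mx polyC X + 'X *: map_mx polyC C.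
have eval_P y : map_mx (horner_eval y) P = X + y *: C.
  rewrite map_mxD map_horner_polyC map_mxZ map_horner_polyC.
  by rewrite /= /horner_eval hornerX.
have [d Pd] := horner_congr0 ((\adj P) i j) z; exists d.
have X0 : X = X + 0 *: C by rewrite scale0r addr0.
by rewrite [in RHS]X0 -!eval_P -!map_mx_adj mxE [in RHS]mxE.
Qed.

(** Otherwise [p ^ r], which divides [m] times the binomial coefficient, would divide [m] itself,
    although [0 < m < p ^ r]. *)
Lemma prime_power_dvd_bin (p r m : nat) : prime p -> (0 < m < p ^ r)%N ->
  (p %| 'C(p ^ r, m))%N.
Proof.
case: m => // m p_pr /= lt_mq.
apply: contraFT (gtnNdvd (ltn0Sn m) lt_mq) => p_ndvd.
have : (p ^ r %| 'C(p ^ r, m.+1) * m.+1)%N by rewrite mulnC -mul_bin_diag dvdn_mulr.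
by rewrite Gauss_dvdr // coprimeXl // prime_coprime.
Qed.

(** Frobenius with an explicit multiple of [p] as error. The ring may be noncommutative, since [x]
    commutes with 1; it will be a matrix ring. *)
Lemma exprD1_prime_power (S : pzRingType) (x : S) (p r : nat) : prime p ->
  exists y, (x + 1) ^+ (p ^ r) = x ^+ (p ^ r) + 1 + y *+ p.
Proof.
move=> p_pr; have q_gt0 : (0 < p ^ r)%N by rewrite expn_gt0 prime_gt0.
have p_bin m : (0 < m < p ^ r)%N -> (p %| 'C(p ^ r, m))%N.
  exact: prime_power_dvd_bin.
case: (p ^ r)%N q_gt0 p_bin => // n _ p_bin.
exists (\sum_(i < n) x ^+ i.+1 *+ ('C(n.+1, i.+1) %/ p)).
rewrite exprD1n big_ord_recl big_ord_recr /= bin0 expr0 mulr1n /bump /= add1n.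
rewrite binn mulr1n addrA [RHS]addrAC -sumrMnl [_ + 1]addrC.
rewrite -[LHS]addrA [\sum_(i < n) _ + _]addrC; congr (_ + (_ + _)).
by apply: eq_bigr => i _; rewrite -mulrnA divnK // p_bin //= ltnS ltn_ord.
Qed.

End Adjugates.

(** * Powers of a matrix [B] for which [B - 1] has an adjugate of rank one *)

Section PowersOfCorank1.
Variables (R : comNzRingType) (n : nat) (w : 'rV[R]_n).
Let J : 'M[R]_n := const_mx 1 *m w.
Let f : R := \sum_i w 0 i.

(** As [w *m const_mx 1] is the scalar [f], the square of [J] is [f *: J]. *)
Lemma rank1_expr m : J ^+ m.+1 = f ^+ m *: J.
Proof.
elim: m => [|m IHm]; first by rewrite expr1 expr0 scale1r.
rewrite exprSr IHm -mulmxE -scalemxAl [f ^+ m.+1]exprSr -scalerA; congr (_ *: _).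
have wu : w *m const_mx 1 = f%:M.
  rewrite [RHS]mx11_scalar mxE [w *m _]mx11_scalar mxE; congr (_%:M).
  by rewrite eqxx /f; apply: eq_bigr => i _; rewrite mxE mulr1.
by rewrite /J -mulmxA [w *m _]mulmxA wu mul_scalar_mx -scalemxAr.
Qed.

Lemma adj_expr (N : 'M[R]_n) m : \adj (N ^+ m) = \adj N ^+ m.
Proof.
elim: m => [|m IHm]; first by rewrite !expr0 adj1.
by rewrite exprS exprSr -!mulmxE adj_mulmx IHm.
Qed.

(** Both claims are read off from the entry [(i0, i0)] of the adjugates, where [J] has the unit
    [w 0 i0]. *)
Lemma adj_power_sub1 (B : 'M[R]_n) (i0 : 'I_n) (v c c' : R) (p r : nat) :
    prime p -> w 0 i0 * v = 1 ->
    \adj (B - 1) = c *: J -> \adj (B ^+ (p ^ r) - 1) = c' *: J ->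
  (exists d, c' = d * c) /\
  (exists d, c' = c ^+ (p ^ r) * f ^+ (p ^ r).-1 + p%:R * d).
Proof.
move=> p_pr wv adjB adjBq.
have JE j : J j i0 = w 0 i0 by rewrite mxE big_ord1 mxE mul1r.
have c'E : c' = (\adj (B ^+ (p ^ r) - 1)) i0 i0 * v.
  by rewrite adjBq mxE JE -mulrA wv mulr1.
split.
  (* Each column of [J] is constant, so row [i0] of [\adj S] meets it in the sum of that row. *)
  set S := \sum_(i < p ^ r) B ^+ i; exists (\sum_j (\adj S) i0 j).
  rewrite c'E subrX1 -mulmxE adj_mulmx adjB -scalemxAr mxE.
  rewrite -mulrA mulrC; congr (_ * _).
  rewrite mxE mulr_suml; apply: eq_bigr => j _.
  by rewrite JE -mulrA wv mulr1.
(* Frobenius is applied to [B = (B - 1) + 1]; the summand 1 then cancels against the one subtracted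
   from [B ^+ (p ^ r)]. *)
have [Y] := exprD1_prime_power (B - 1) r p_pr; rewrite subrK => BqE.
have [d] := adj_congr p%:R ((B - 1) ^+ (p ^ r)) Y i0 i0.
have -> : (B - 1) ^+ (p ^ r) + p%:R *: Y = B ^+ (p ^ r) - 1.
  by rewrite BqE scaler_nat [_ + 1 + _]addrAC addrK.
move=> adjE; exists (d * v); rewrite c'E adjE adj_expr adjB.
have -> : (c *: J) ^+ (p ^ r) = c ^+ (p ^ r) *: J ^+ (p ^ r).
  elim: (p ^ r)%N => [|m IHm]; first by rewrite !expr0 scale1r.
  by rewrite !exprS IHm -!mulmxE -scalemxAl -scalemxAr scalerA.
(* The exponent must be a successor for [rank1_expr], which accounts for the power [(p ^ r).-1] of
   [f]. *)
rewrite -[in J ^+ _](prednK (n := p ^ r)) ?expn_gt0 ?prime_gt0 //.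
by rewrite rank1_expr scalerA mxE JE mulrDl -[X in X + _]mulrA wv mulr1 mulrA.
Qed.

End PowersOfCorank1.

(** * Laurent polynomials *)

Lemma laurent_val_inj : injective laurent_val.
Proof. exact: val_inj. Qed.

Lemma laurent_valM (a b : laurent) : laurent_val (a * b) = laurent_val a * laurent_val b.
Proof. exact: (rmorphM (val : laurent -> {fraction {poly int}})). Qed.

Lemma laurent_val1 : laurent_val 1 = 1.
Proof. exact: (rmorph1 (val : laurent -> {fraction {poly int}})). Qed.

Lemma laurent_val0 : laurent_val 0 = 0.
Proof. exact: (rmorph0 (val : laurent -> {fraction {poly int}})). Qed.

Lemma laurent_valN (a : laurent) : laurent_val (- a) = - laurent_val a.
Proof. exact: (rmorphN (val : laurent -> {fraction {poly int}})). Qed.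

Lemma laurent_valX (a : laurent) n : laurent_val (a ^+ n) = laurent_val a ^+ n.
Proof. exact: (rmorphXn (val : laurent -> {fraction {poly int}})). Qed.

Lemma tpowD m n : tpow (m + n) = tpow m * tpow n.
Proof. by apply: laurent_val_inj; rewrite laurent_valM /= expfzDr ?tfrac_neq0. Qed.

Lemma tpow0 : tpow 0 = 1.
Proof. by apply: laurent_val_inj; rewrite laurent_val1. Qed.

Lemma tpowNK m : tpow m * tpow (- m) = 1.
Proof. by rewrite -tpowD subrr tpow0. Qed.

(** Evaluation at 0 shows that one of the factors is divisible by ['X], which is then cancelled; for
    [n = 0] only the units 1 and -1 are left. *)
Lemma poly_dvd_Xn (f g : {poly int}) n : f * g = 'X^n ->
  exists (e : bool) m, f = (-1) ^+ e * 'X^m.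
Proof.
have X0 : 'X != 0 :> {poly int} by rewrite polyX_eq0.
have factorX (h : {poly int}) : h.[0] = 0 -> exists h', h = h' * 'X.
  by move=> /rootP/factor_theorem[h' ->]; exists h'; rewrite subr0.
elim: n f g => [|n IHn] f g fg.
  have : f \is a GRing.unit by apply/unitrPr; exists g.
  rewrite poly_unitE => /andP[/eqP f1 /orP[]/eqP f0].
    by exists false, 0%N; rewrite [f]size1_polyC ?f1 // f0 mul1r.
  by exists true, 0%N; rewrite [f]size1_polyC ?f1 // f0 mulr1 polyCN.
have /eqP := congr1 (fun h => h.[0]) fg.
rewrite hornerM hornerXn expr0n mulf_eq0 => /orP[]/eqP/factorX[h def_h].
  have [|e [m def_m]] := IHn h g.
    by apply: (mulIf X0); rewrite -exprSr -fg def_h mulrAC.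
  by exists e, m.+1; rewrite def_h def_m exprSr mulrA.
by apply: (IHn f h); apply: (mulIf X0); rewrite -exprSr -fg def_h mulrA.
Qed.

Lemma cross_mul (F : fieldType) (x y u v : F) :
  u != 0 -> v != 0 -> (x / u) * (y / v) = 1 -> x * y = u * v.
Proof.
by move=> u0 v0; rewrite mulf_div => /divr1_eq.
Qed.

(** Clearing denominators turns the equation into a factorization of a power of ['X]. *)
Lemma laurent_unit (a b : laurent) : a * b = 1 ->
  exists (e : bool) m, a = (-1) ^+ e * tpow m.
Proof.
case: a b => [a aP] [b bP] /(congr1 laurent_val).
rewrite laurent_valM laurent_val1 /=; have := bP; have := aP.
move=> /asboolP[f [m def_a]] /asboolP[g [n def_b]] ab1.
have t0 l : tfrac ^+ l != 0 by rewrite expf_neq0 ?tfrac_neq0.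
have [|e [l def_f]] := @poly_dvd_Xn f g (m + n).
  apply/eqP; rewrite -tofrac_eq rmorphM rmorphXn exprD; apply/eqP.
  by apply: cross_mul; [exact: t0 | exact: t0 | rewrite -def_a -def_b].
exists e, (l%:Z - m%:Z); apply: laurent_val_inj.
rewrite laurent_valM laurent_valX laurent_valN laurent_val1 /=.
rewrite def_a def_f expfzDr ?tfrac_neq0 // -exprnN rmorphM !rmorphXn rmorphN1.
by rewrite mulrA.
Qed.

(** The two quotients multiply to 1, because a nonzero [a] can be cancelled in the fraction
    field. *)
Lemma laurent_generator (a b : laurent) : ldvd a b -> ldvd b a -> doteq a b.
Proof.
move=> [x bE] [y aE]; have [a0|a_neq0] := eqVneq a 0.
  by exists false, 0; rewrite bE a0 !mulr0.
suff /laurent_unit[e [m yE]] : y * x = 1 by exists e, m; rewrite -yE.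
apply/eqP; rewrite -subr_eq0; apply/eqP/laurent_val_inj/eqP.
have : laurent_val (y * x - 1) * laurent_val a == 0.
  by rewrite -laurent_valM mulrBl mul1r -mulrA -bE -aE subrr laurent_val0.
rewrite mulf_eq0 => /orP[|/eqP a0]; first by rewrite laurent_val0.
by case/eqP: a_neq0; apply: laurent_val_inj; rewrite a0 laurent_val0.
Qed.

(** Up to sign every minor is [c * w i], and the minor at [(i0, i0)] is [c] times a unit, so it
    alone generates the ideal. *)
Lemma in_minor_idealP n (A : 'M[laurent]_n) c (w : 'I_n -> laurent) i0 v x :
    (forall i j, (\adj A) j i = c * w i) -> w i0 * v = 1 ->
  in_minor_ideal A x <-> ldvd c x.
Proof.
move=> adjA wv.
have minorE i j : \det (row' i (col' j A)) = (-1) ^+ (i + j) * (c * w i).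
  by rewrite -(adjA i j) mxE /cofactor signrMK.
split=> [[b ->]|[y ->]].
  exists (\sum_i \sum_j b i j * ((-1) ^+ (i + j) * w i)).
  rewrite mulr_suml; apply: eq_bigr => i _; rewrite mulr_suml.
  by apply: eq_bigr => j _; rewrite minorE; ring.
exists (\matrix_(i, j) (((i == i0) && (j == i0))%:R * (y * v))).
rewrite (bigD1 i0) //= (bigD1 i0) //= !mxE !eqxx /= minorE addnn -signr_odd odd_double.
rewrite big1 => [|j /negPf j_i0]; last by rewrite mxE j_i0 andbF !mul0r.
rewrite big1 => [|i /negPf i_i0]; last by rewrite big1 // => j _; rewrite mxE i_i0 !mul0r.
rewrite expr0 !addr0 !mul1r -[LHS]mulr1 -wv; ring.
Qed.

(** * The edge matrix *)

Section EdgeMatrix.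
Variable D : vdiagram.
Local Notation E := (edge D).
Local Notation C := (crossing D).

(** The Wirtinger relations between the labels of the edges: row [e] expresses
    the label of [step e] through the labels of the edges entering there. *)
Definition edge_relation (e e' : E) : laurent :=
  (e' == e)%:R - (e' == step e)%:R
  + \sum_c (e == under_in c)%:R * (1 - tpow (- csign c))
      * ((e' == over_in c)%:R - (e' == under_in c)%:R).

Definition edge_matrix : 'M[laurent]_#|E| :=
  \matrix_(i, j) edge_relation (enum_val i) (enum_val j).

Lemma sum_enum_val (y : E -> laurent) : \sum_(i < #|E|) y (enum_val i) = \sum_e y e.
Proof. by rewrite -(big_enum_val (A := E) y). Qed.

Lemma sum_delta (I : finType) (y : I -> laurent) i :
  \sum_j (j == i)%:R * y j = y i.
Proof.
rewrite (bigD1 i) //= eqxx mul1r big1 ?addr0 // => j /negPf ->.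
by rewrite mul0r.
Qed.

Definition edge_defect (y : E -> laurent) (e : E) : laurent :=
  y e - y (step e)
  + \sum_c (e == under_in c)%:R * (1 - tpow (- csign c))
      * (y (over_in c) - y (under_in c)).

Lemma sum_edge_relation (y : E -> laurent) e :
  \sum_e' edge_relation e e' * y e' = edge_defect y e.
Proof.
rewrite /edge_relation.
under eq_bigr do rewrite mulrDl mulrBl mulr_suml.
rewrite big_split sumrB !sum_delta exchange_big /=; congr (_ + _).
apply: eq_bigr => c _.
rewrite -(sum_delta y (over_in c)) -(sum_delta y (under_in c)) -sumrB mulr_sumr.
by apply: eq_bigr => e' _; rewrite -mulrBl mulrA.
Qed.

Lemma edge_matrix_mul n (Y : E -> 'I_n -> laurent) i j :
  (edge_matrix *m \matrix_(i, j) Y (enum_val i) j) i j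
  = edge_defect (Y^~ j) (enum_val i).
Proof.
rewrite mxE -sum_edge_relation -sum_enum_val.
by apply: eq_bigr => l _; rewrite !mxE.
Qed.

Lemma edge_defect_const x e : edge_defect (fun=> x) e = 0.
Proof.
by rewrite /edge_defect subrr add0r big1 // => c _; rewrite mulr0.
Qed.

Lemma edge_matrix_const : edge_matrix *m const_mx 1 = 0 :> 'cV_#|E|.
Proof.
apply/matrixP => i j.
have -> : const_mx 1 = \matrix_(i < #|E|, j < 1) 1 :> 'cV[laurent]__.
  by apply/matrixP=> l m; rewrite !mxE.
by rewrite (edge_matrix_mul (fun _ _ => 1)) edge_defect_const mxE.
Qed.

Lemma edge_defect_under y c :
  edge_defect y (under_in c) = tpow (- csign c) * y (under_in c) - y (step (under_in c))
    + (1 - tpow (- csign c)) * y (over_in c).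
Proof.
rewrite /edge_defect (bigD1 c) //= eqxx mul1r big1 => [|d dc]; first by ring.
by rewrite (inj_eq (@under_in_inj D)) eq_sym (negPf dc) !mul0r.
Qed.

Variable a : E -> int.
Hypothesis a_num : alexander_numbering a.

(** Column [e'] meets the rows of [e'] and of its predecessor and, if [e'] enters a crossing, the
    row of the under-edge there. In the three cases (over, under, no crossing) the numbering makes
    the resulting powers of [t] cancel in pairs. *)
Lemma alexander_weights (e' : E) :
  \sum_e tpow (a (step e)) * edge_relation e e' = 0.
Proof.
have [a_plain a_crossing] := a_num.
pose g c := tpow (a (step (under_in c))) * (1 - tpow (- csign c)).
have -> : \sum_e tpow (a (step e)) * edge_relation e e'
  = tpow (a (step e')) - tpow (a e')
    + \sum_c g c * ((e' == over_in c)%:R - (e' == under_in c)%:R).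
  rewrite /edge_relation.
  under eq_bigr do rewrite mulrDr mulrBr mulr_sumr.
  rewrite big_split sumrB exchange_big /=; congr (_ - _ + _).
  - rewrite -[RHS](sum_delta (fun e => tpow (a (step e)))).
    by apply: eq_bigr => e _; rewrite eq_sym mulrC.
  - rewrite -[RHS](sum_delta (fun e => tpow (a e))).
    rewrite [RHS](reindex_inj (@step_inj D)) /=.
    by apply: eq_bigr => e _; rewrite eq_sym mulrC.
  apply: eq_bigr => c _.
  rewrite /g -(sum_delta (fun e => tpow (a (step e)) * (1 - tpow (- csign c)))) mulr_suml.
  by apply: eq_bigr => e _; ring.
have [/codomP[c ->]|e'_o] := boolP (e' \in codom (@over_in D)).
  rewrite (bigD1 c) //= eqxx (negPf (over_under_neq c c)) big1 => [|d dc]; last first.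
    by rewrite (inj_eq (@over_in_inj D)) eq_sym (negPf dc)
      (negPf (over_under_neq c d)) subrr mulr0.
  rewrite subr0 mulr1 addr0 /g mulrBr mulr1 -tpowD /csign.
  have [l] := a_crossing c; case: (positive c) => -[E1 E2 E3 E4];
    rewrite ?E1 ?E2 ?E3 ?E4 ?opprK ?addrK; ring.
rewrite (eq_bigr (fun c => - (g c * (e' == under_in c)%:R))); last first.
  move=> c _; case: eqP e'_o => [->|_ _]; first by rewrite codom_f.
  by rewrite sub0r mulrN.
have [/codomP[c ->]|e'_u] := boolP (e' \in codom (@under_in D)).
  rewrite (bigD1 c) //= !eqxx big1 => [|d dc]; last first.
    by rewrite (inj_eq (@under_in_inj D)) [c == d]eq_sym (negPf dc) mulr0 oppr0.
  rewrite mulr1 addr0 /g mulrBr mulr1 -tpowD /csign.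
  have [l] := a_crossing c; case: (positive c) => -[E1 E2 E3 E4];
    rewrite ?E1 ?E2 ?E3 ?E4 ?opprK ?addrK; ring.
rewrite a_plain // subrr add0r big1 // => c _.
by case: eqP e'_u => [->|_]; rewrite ?codom_f // mulr0 oppr0.
Qed.

Lemma adj_edge_matrix : (0 < #|E|)%N ->
  exists c, forall e e', (\adj edge_matrix) (enum_rank e') (enum_rank e)
    = c * tpow (a (step e)).
Proof.
move=> E_gt0; pose w : 'rV_#|E| := \row_i tpow (a (step (enum_val i))).
pose i0 := Ordinal E_gt0.
have [|||c adjE] := @adj_corank1 _ _ edge_matrix w i0 (tpow (- a (step (enum_val i0)))).
- exact: edge_matrix_const.
- apply/rowP => j; rewrite !mxE -[RHS](alexander_weights (enum_val j)).
  rewrite -[RHS]sum_enum_val; by apply: eq_bigr => i _; rewrite !mxE.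
- by rewrite mxE tpowNK.
by exists c => e e'; rewrite adjE !(mxE, big_ord1) enum_rankK mul1r.
Qed.

End EdgeMatrix.

(** By [laurent_unit], [doteq] is association up to a unit; symmetry and transitivity follow from
    this form. *)
Lemma doteqP (a b : laurent) : doteq a b <-> exists u v, u * v = 1 /\ a = u * b.
Proof.
split=> [[e [m ->]]|[u [v [/laurent_unit[e [m ->]] ->]]]]; last by exists e, m.
exists ((-1) ^+ e * tpow m), ((-1) ^+ e * tpow (- m)); split=> //.
by rewrite mulrACA -exprD addnn -signr_odd odd_double mul1r tpowNK.
Qed.

Lemma doteq_sym (a b : laurent) : doteq a b -> doteq b a.
Proof.
move=> /doteqP[u [v [uv ->]]]; apply/doteqP; exists v, u; split; first by rewrite mulrC.
by rewrite mulrA [v * u]mulrC uv mul1r.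
Qed.

Lemma doteq_trans (b a c : laurent) : doteq a b -> doteq b c -> doteq a c.
Proof.
move=> /doteqP[u [v [uv ->]]] /doteqP[u' [v' [uv' ->]]]; apply/doteqP.
exists (u * u'), (v * v'); split; last by rewrite mulrA.
by rewrite mulrACA uv uv' mul1r.
Qed.

(** * From the edge matrix to the Alexander polynomial *)

Section AlexanderPolynomial.
Variable D : vdiagram.
Local Notation E := (edge D).
Local Notation C := (crossing D).

(** Elimination matrix: labels are carried unchanged along the strands, except that they are
    prescribed on the edges in [P]. *)
Definition cut_matrix (P : pred E) : 'M[laurent]_#|E| :=
  \matrix_(i, j) let e := enum_val i in let e' := enum_val j in
    if P e then (e' == e)%:R else (e' == e)%:R - (e' == step e)%:R.

(** The number of steps needed to reach [P] decreases along [step], so only the identity permutation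
    contributes. *)
Lemma det_cut_matrix (P : pred E) :
  (forall e, exists m, P (iter m (@step D) e)) -> \det (cut_matrix P) = 1.
Proof.
move=> P_reach; pose rank e := ex_minn (P_reach e).
have rank_step e : ~~ P e -> (rank (step e) < rank e)%N.
  rewrite /rank; case: ex_minnP => m _ m_min; case: ex_minnP => -[|n].
    by move=> /= ->.
  by rewrite iterSr => /m_min le_mn _ _.
rewrite (@det_ranked _ _ _ 1%g (fun i => rank (enum_val i))).
  rewrite odd_perm1 expr0 mul1r big1 // => i _; rewrite mxE perm1 /= eqxx.
  (* An edge outside [P] with [step e = e] would have diagonal entry 0; the strict decrease of
     [rank] excludes it. *)
  case: ifPn => // /rank_step; case: eqP => [<-|_ _]; first by rewrite ltnn.
  by rewrite subr0.
move=> i j; rewrite mxE perm1 /=; have [ij|ij] := eqVneq (enum_val j) (enum_val i).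
  by left; apply: enum_val_inj.
case: ifPn => [|/rank_step]; first by rewrite mulr0n eqxx.
by case: (enum_val j =P _) => [->|_ _]; [right | rewrite subrr eqxx].
Qed.

Lemma in_arc_under c d : in_arc c (@under_in D d) = (c == d).
Proof.
apply/connectP/eqP => [[[|e p] /=]|->]; last by exists [::].
  by move=> _ /under_in_inj.
by rewrite codom_f.
Qed.

Lemma in_arc_step c e : e \notin codom (@under_in D) ->
  in_arc c (step e) = in_arc c e.
Proof.
move=> e_u; apply/idP/idP => [|/connectP[[|e' p] /=]].
- by apply: connect_trans; apply: connect1; rewrite /= e_u eqxx.
- by move=> _ def_e; rewrite -def_e codom_f in e_u.
case/andP => /andP[_ /eqP->] e_p def_c; apply/connectP; by exists p.
Qed.

(** Elimination with [Y] giving every edge the label of its arc: this solves the relations at all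
    edges not entering an undercrossing, and the rows left over are those of the Alexander
    matrix. *)
Lemma adj_alexander_matrix (i j : 'I_#|C|) :
    (forall e, exists m, iter m (@step D) e \in codom (@under_in D)) ->
  (\adj (alexander_matrix D)) j i
  = (\adj (edge_matrix D)) (enum_rank (under_in (enum_val j)))
      (enum_rank (under_in (enum_val i))).
Proof.
move=> /(@det_cut_matrix (fun e => e \in codom (@under_in D))) det_cut.
pose v (c : 'I_#|C|) := enum_rank (@under_in D (enum_val c)).
have v_inj : injective v.
  by move=> c d /enum_rank_inj/under_in_inj/enum_val_inj.
pose Y e (d : 'I_#|C|) : laurent := (in_arc (enum_val d) e)%:R.
rewrite -!det_replace_row_delta -/(v i) -/(v j).
rewrite (@det_elim _ _ _ _ (cut_matrix (fun e => e \in codom (@under_in D)))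
  (\matrix_(i, j) Y (enum_val i) j) v) //.
- rewrite det_cut mul1r mul_replace_row rowsub_replace_row //; congr (\det _).
  have -> : (delta_mx 0 (v j) : 'rV_#|E|) *m \matrix_(i, j) Y (enum_val i) j
      = delta_mx 0 j.
    rewrite -rowE; apply/rowP => d; rewrite !mxE /Y enum_rankK in_arc_under.
    by rewrite (inj_eq enum_val_inj) eqxx.
  congr (replace_row _ _ _); apply/matrixP => c d; rewrite [RHS]mxE.
  by rewrite edge_matrix_mul enum_rankK edge_defect_under mxE.
- move=> l l_v; apply/rowP => m; rewrite !mxE.
  have l_u : enum_val l \notin codom (@under_in D).
    apply: contra l_v => /codomP[c def_l]; apply/codomP; exists (enum_rank c).
    by rewrite /v enum_rankK -def_l enum_valK.
  rewrite ifN; last by apply: contra l_v => /eqP->; rewrite codom_f.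
  rewrite /= (negPf l_u) /edge_relation big1 ?addr0 // => c _.
  by case: eqP l_u => [->|_]; rewrite ?codom_f ?mul0r.
move=> l d; rewrite mxE.
rewrite (eq_bigr (fun m => (if enum_val l \in codom (@under_in D) then
    (enum_val m == enum_val l)%:R
    else (enum_val m == enum_val l)%:R - (enum_val m == step (enum_val l))%:R)
  * Y (enum_val m) d)); last by move=> m _; rewrite !mxE.
rewrite (sum_enum_val (fun e => (if enum_val l \in codom (@under_in D) then
    (e == enum_val l)%:R else (e == enum_val l)%:R - (e == step (enum_val l))%:R)
  * Y e d)).
have [/codomP[c def_l]|l_u] := boolP (enum_val l \in codom (@under_in D)).
  rewrite sum_delta /Y def_l in_arc_under -[l]enum_valK def_l.
  by rewrite (inj_eq enum_rank_inj) (inj_eq (@under_in_inj D)) eq_sym.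
under eq_bigr do rewrite mulrBl.
rewrite sumrB !sum_delta /Y in_arc_step // subrr.
by case: eqP l_u => // ->; rewrite enum_rankK codom_f.
Qed.

Lemma alexander_polynomial_edge_matrix (a : E -> int) c Delta :
    is_knot D ->
    (forall e e', (\adj (edge_matrix D)) (enum_rank e') (enum_rank e)
       = c * tpow (a (step e))) ->
  is_alexander_polynomial D Delta -> doteq Delta c.
Proof.
move=> [E_gt0 D_knot] adjE; rewrite /is_alexander_polynomial.
have reach e e' : exists m, iter m (@step D) e = e'.
  by exists (findex (@step D) e e'); rewrite iter_findex.
case: ifPn => [/eqP C0|C_gt0] Delta_gen.
  apply: (doteq_trans Delta_gen); apply: doteq_sym; apply/doteqP.
  (* Without crossings, the edge matrix with row [e0] replaced by the unit vector at [e0] is a cut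
     matrix, of determinant 1; hence [c] is a unit. *)
  pose e0 : E := enum_val (Ordinal E_gt0).
  exists c, (tpow (a (step e0))); split; last by rewrite mulr1.
  rewrite -(adjE e0 e0) -det_replace_row_delta -[RHS](@det_cut_matrix (pred1 e0)).
    congr (\det _); apply/matrixP => i j; rewrite !mxE /= -(inj_eq enum_val_inj) enum_rankK.
    case: ifP => [/eqP->|_]; first by rewrite -(inj_eq enum_val_inj) enum_rankK.
    rewrite /edge_relation big1 ?addr0 // => d _.
    by have := max_card (pred1 d); rewrite card1 C0.
  by move=> e; have [m def_e0] := reach e e0; exists m; rewrite /= def_e0.
rewrite -lt0n in C_gt0; pose i0 := Ordinal C_gt0.
have adjA i j : (\adj (alexander_matrix D)) j i
    = c * tpow (a (step (under_in (enum_val i)))).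
  rewrite adj_alexander_matrix // => e.
  have [m def_m] := reach e (under_in (enum_val i0)).
  by exists m; rewrite def_m codom_f.
have idealE x := in_minor_idealP x adjA (tpowNK (a (step (under_in (enum_val i0))))).
apply: laurent_generator.
  by apply/Delta_gen/idealE; exists 1; rewrite mul1r.
by apply/idealE/Delta_gen; exists 1; rewrite mul1r.
Qed.

End AlexanderPolynomial.

(** * Closed braids *)

Section BraidMatrix.
Variable k : nat.

Definition under_pos (b : bool) (i : 'I_k.-1) : 'I_k := if b then lpos i else rpos i.
Definition over_pos (b : bool) (i : 'I_k.-1) : 'I_k := if b then rpos i else lpos i.

Definition letter_perm (g : letter k) : {perm 'I_k} := tperm (lpos g.2) (rpos g.2).

(** Maps the labels of the strands above the letter to those below it. *)
Definition letter_matrix (g : letter k) : 'M[laurent]_k :=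
  \matrix_(j, j') (let i := letter_perm g j in
    (j' == i)%:R
    + if g.1 is Some b then
        (i == under_pos b g.2)%:R * (1 - tpow (- (if b then 1 else -1)))
          * ((j' == over_pos b g.2)%:R - (j' == under_pos b g.2)%:R)
      else 0).

(** A Burau-type matrix acting on columns of strand labels, so letters further down multiply from
    the left. *)
Definition braid_matrix (w : vbraid k) : 'M[laurent]_k :=
  foldl (fun X g => letter_matrix g *m X) 1%:M w.

Lemma braid_matrix_cat w1 w2 :
  braid_matrix (w1 ++ w2) = braid_matrix w2 *m braid_matrix w1.
Proof.
rewrite /braid_matrix foldl_cat; move: (foldl _ _ w1) => X.
elim/last_ind: w2 => [|w2 g IHw]; first by rewrite mul1mx.
by rewrite !foldl_rcons IHw mulmxA.
Qed.

Lemma braid_matrix_pow w q : braid_matrix (vbraid_pow w q) = braid_matrix w ^+ q.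
Proof.
elim: q => [|q IHq] //; rewrite exprSr -mulmxE -IHq.
by rewrite -braid_matrix_cat.
Qed.

Lemma letter_matrix_mul n g (X : 'M[laurent]_(k, n)) j i :
  (letter_matrix g *m X) (letter_perm g j) i
  = X j i + if g.1 is Some b then
      (j == under_pos b g.2)%:R * (1 - tpow (- (if b then 1 else -1)))
        * (X (over_pos b g.2) i - X (under_pos b g.2) i)
    else 0.
Proof.
rewrite mxE; under eq_bigr do rewrite mxE /letter_perm tpermK -/(letter_perm g) mulrDl.
rewrite big_split sum_delta /=; congr (_ + _).
case: g.1 => [b|]; last by rewrite big1 // => l _; rewrite mul0r.
rewrite -(sum_delta (X^~ i) (over_pos b g.2)) -(sum_delta (X^~ i) (under_pos b g.2)).
by rewrite -sumrB mulr_sumr; apply: eq_bigr => l _; rewrite -mulrBl mulrA.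
Qed.

Variable w : vbraid k.
Let D := cb_diagram w.
Let L := size w.

(** A level carries at most one letter, hence at most one term survives. *)
Lemma sum_crossings_level (F : cb_crossing w -> laurent) (e : cb_edge w) :
  \sum_c (e == cb_under_in c)%:R * F c
  = if [pick c : cb_crossing w | (val c).1.1 == e.1] is Some c then
      (e.2 == under_pos (val c).1.2 (val c).2)%:R * F c
    else 0.
Proof.
have level_eq c : (e == cb_under_in c)
    = ((val c).1.1 == e.1) && (e.2 == under_pos (val c).1.2 (val c).2).
  by case: e => s j; rewrite xpair_eqE eq_sym.
case: pickP => [c /eqP c_e|no_c].
  rewrite (bigD1 c) //= level_eq c_e eqxx big1 ?addr0 // => d /eqP dc.
  rewrite level_eq; case: eqP => [d_e|_]; last by rewrite mul0r.
  by case: dc; apply: cb_crossing_inj; rewrite d_e.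
by rewrite big1 // => c _; rewrite level_eq no_c mul0r.
Qed.

Lemma level_crossing (s : 'I_L.+1) (c : cb_crossing w) :
  (val c).1.1 = s -> onth w s = Some (Some (val c).1.2, (val c).2).
Proof. by move=> <-; apply/eqP/(valP c). Qed.

Lemma crossing_of_letter (s : 'I_L.+1) b i : onth w s = Some (Some b, i) ->
  exists c : cb_crossing w, val c = (s, b, i).
Proof. by move=> /eqP w_s; exists (Sub (s, b, i) w_s). Qed.

(** The labels on all levels when the top strand [i] has label 1 and the other top strands have
    label 0. *)
Definition strand_labels (e : cb_edge w) (i : 'I_k) : laurent :=
  braid_matrix (take e.1 w) e.2 i.

(** Level [size w] has no letter, and its pieces return to level 0, where the labels form the
    identity matrix; the defect measures the failure to close up. *)
Lemma edge_defect_last j i :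
  @edge_defect D (strand_labels^~ i) (ord_max, j) = (braid_matrix w - 1%:M) j i.
Proof.
rewrite /edge_defect /= /cb_step /level_perm /=.
rewrite /strand_labels /= onth_default // perm1 modnn take0 take_size.
under eq_bigr do rewrite -mulrA.
rewrite sum_crossings_level; case: pickP => [c /eqP/level_crossing|_].
  by rewrite onth_default.
by rewrite addr0 [RHS]mxE [X in _ = _ + X]mxE.
Qed.

Lemma edge_defect_inner (s : 'I_L.+1) j i : (s < L)%N ->
  @edge_defect D (strand_labels^~ i) (s, j) = 0.
Proof.
move=> lt_sL; rewrite /edge_defect /= /cb_step /level_perm /=.
have [g w_s] : exists g, onth w s = Some g.
  by case w_s: (onth w s) => [g|]; [exists g | have := onthTE w s; rewrite w_s lt_sL].
rewrite /strand_labels /= modn_small ?ltnS // w_s.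
rewrite (take_nth g lt_sL). rewrite (onth_nth _ _ _ _ w_s) -cats1 braid_matrix_cat.
have -> : braid_matrix [:: g] = letter_matrix g by rewrite /braid_matrix /= mulmx1.
rewrite -/(letter_perm g) letter_matrix_mul.
under eq_bigr do rewrite -mulrA.
rewrite sum_crossings_level /= opprD addrA subrr add0r addrC.
apply/eqP; rewrite subr_eq0; apply/eqP.
case: pickP => [c /eqP c_s|no_c].
  move: (level_crossing c_s); rewrite w_s => -[->] /=.
  rewrite mulrA /csign /= /cb_positive /cb_over_in /cb_under_in /cb_positive.
  by rewrite /= c_s.
case: g w_s => [[b|] l] w_s //=.
have [c c_E] := crossing_of_letter w_s.
by have := no_c c; rewrite c_E eqxx.
Qed.

(** Elimination matrix of the braid before closing: the rows of the bottom pieces prescribe the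
    labels at the top instead of stating the closing relations. *)
Definition open_matrix : 'M[laurent]_#|edge D| :=
  \matrix_(i, j) let e : edge D := enum_val i in
    if e.1 == ord_max then (enum_val j == step e)%:R else edge_relation e (enum_val j).

Lemma edge_relation_level (e e' : edge D) :
  e'.1 != e.1 -> edge_relation e e' = - (e' == step e)%:R.
Proof.
move=> neq_level; rewrite /edge_relation; have /negPf-> : e' != e.
  by apply: contraNneq neq_level => ->.
rewrite big1 ?addr0 ?sub0r // => c _.
case: eqP => [def_e|_]; last by rewrite !mul0r.
have /negPf-> : e' != over_in c by apply: contraNneq neq_level => ->; rewrite def_e.
have /negPf-> : e' != under_in c by apply: contraNneq neq_level => ->; rewrite def_e.
by rewrite subrr mulr0.
Qed.

(** Besides [step e], the row of an inner edge only meets its own level, which is one less than that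
    of [step e]. Hence only the permutation [step] contributes, with entries 1 and -1; squaring
    absorbs the sign. *)
Lemma det_open_matrix : \det open_matrix * \det open_matrix = 1.
Proof.
pose step_rank (i : 'I_#|edge D|) := enum_rank (step (enum_val i)).
have step_rank_inj : injective step_rank.
  by move=> i j /enum_rank_inj/step_inj/enum_val_inj.
have step_level (e : edge D) : e.1 != ord_max -> ((step e).1 = e.1.+1 :> nat)%N.
  case: e => s j /= s_max; rewrite modn_small // ltnS ltn_neqAle.
  by rewrite -ltnS ltn_ord andbT; apply: contra s_max => /eqP s_L; apply/eqP/val_inj.
rewrite (@det_ranked _ _ _ (perm step_rank_inj) (fun i => (enum_val i : edge D).1)).
  rewrite mulrACA -exprD addnn -signr_odd odd_double mul1r -big_split /= big1 // => i _.
  rewrite mxE permE /= enum_rankK; case: ifPn => [_|i_max]; first by rewrite eqxx mulr1.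
  rewrite edge_relation_level ?eqxx ?mulrNN ?mulr1 //.
  by have /eqP := step_level _ i_max; apply: contraTneq => ->; rewrite ltn_eqF.
move=> i j; rewrite mxE permE /= enum_rankK.
have [def_j|j_step] := eqVneq (enum_val j) (step (enum_val i)).
  by left; apply: enum_val_inj; rewrite enum_rankK.
case: ifPn => [|i_max]; first by rewrite eqxx.
have [same|diff] := eqVneq (enum_val j : edge D).1 (enum_val i : edge D).1.
  by right; rewrite step_level // same.
by rewrite edge_relation_level // (negPf j_step) oppr0 eqxx.
Qed.

(** Elimination with [strand_labels]: the inner relations hold by propagation, and the bottom rows
    become those of [braid_matrix w - 1]. *)
Lemma adj_edge_matrix_closure (j0 j : 'I_k) :
  (\adj (edge_matrix D)) (enum_rank ((ord0, j0) : edge D))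
      (enum_rank ((ord_max, j) : edge D))
  = \det open_matrix * (\adj (braid_matrix w - 1%:M)) j0 j.
Proof.
pose v (i : 'I_k) := enum_rank ((ord_max, i) : edge D).
have v_inj : injective v by move=> i l /enum_rank_inj[].
rewrite -!det_replace_row_delta -/(v j).
rewrite (@det_elim _ _ _ _ open_matrix (\matrix_(i, j) strand_labels (enum_val i) j) v) //.
- congr (_ * \det _); rewrite mul_replace_row rowsub_replace_row //.
  rewrite -rowE; congr (replace_row _ _ _); apply/matrixP => i l.
    by rewrite mxE (@edge_matrix_mul D) enum_rankK edge_defect_last.
  by rewrite !mxE /strand_labels enum_rankK /= take0 !mxE [l == j0]eq_sym (ord1 i) eqxx.
- move=> l l_v; apply/rowP => m; rewrite !mxE /=.
  have l_max : (enum_val l : edge D).1 != ord_max.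
    apply: contra l_v => /eqP l_max; apply/codomP; exists (enum_val l : edge D).2.
    by apply: enum_val_inj; rewrite enum_rankK; case: (enum_val l) l_max => s i /= ->.
  by rewrite ifN ?(negPf l_max) //; apply: contra l_v => /eqP->; rewrite codom_f.
move=> l i; have [l_max|l_max] := eqVneq (enum_val l : edge D).1 ord_max.
  have -> : l = v (enum_val l : edge D).2.
    by apply: enum_val_inj; rewrite enum_rankK; case: (enum_val l) l_max => s m /= ->.
  move: (enum_val l : edge D).2 => m; rewrite (inj_eq v_inj) mxE.
  rewrite (eq_bigr (fun n => (enum_val n == ((ord0, m) : edge D))%:R
    * strand_labels (enum_val n) i)).
    rewrite (@sum_enum_val D (fun e => (e == ((ord0, m) : edge D))%:R
      * strand_labels e i)).
    by rewrite sum_delta /strand_labels take0 mxE.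
  move=> n _; rewrite !mxE enum_rankK /= eqxx /cb_step /level_perm /= onth_default // perm1.
  by congr ((_ == (_, _))%:R * _); apply: val_inj; rewrite /= modnn.
rewrite mxE (eq_bigr (fun n => edge_relation (enum_val l : edge D) (enum_val n)
  * strand_labels (enum_val n) i)); last by move=> n _; rewrite !mxE /= (negPf l_max).
rewrite (@sum_enum_val D (fun e => edge_relation (enum_val l : edge D) e * strand_labels e i)).
rewrite sum_edge_relation.
have -> : l == v i = false.
  by apply/eqP=> def_l; rewrite def_l enum_rankK eqxx in l_max.
case: (enum_val l) l_max => s m /= s_max; apply: edge_defect_inner.
rewrite ltn_neqAle -ltnS ltn_ord andbT; apply: contra s_max => /eqP s_L.
by apply/eqP/val_inj.
Qed.

Lemma closure_alexander_polynomial (a : cb_edge w -> int) :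
    (0 < k)%N -> @alexander_numbering D a -> is_knot D ->
  exists c, \adj (braid_matrix w - 1%:M)
      = c *: (const_mx 1 *m \row_j tpow (a (ord0, j)))
    /\ forall Delta, is_alexander_polynomial D Delta -> doteq Delta c.
Proof.
move=> k_gt0 a_num D_knot; have [E_gt0 _] := D_knot.
have [c adjE] := adj_edge_matrix a_num E_gt0.
exists (\det open_matrix * c); split.
  apply/matrixP => j0 j; rewrite !mxE big_ord1 !mxE mul1r.
  (* A row is weighted by the number of the edge following it; the bottom piece is followed by the
     top one. *)
  have -> : tpow (a (ord0, j)) = tpow (a (@step D (ord_max, j))).
    rewrite /= /cb_step /level_perm /= onth_default // perm1.
    by congr (tpow (a (_, _))); apply: val_inj; rewrite /= modnn.
  rewrite -mulrA -(adjE ((ord_max, j) : edge D) ((ord0, j0) : edge D)).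
  rewrite adj_edge_matrix_closure mulrA det_open_matrix mul1r.
  by rewrite [in RHS]mxE.
move=> Delta /(alexander_polynomial_edge_matrix D_knot adjE) Delta_c.
apply: (doteq_trans Delta_c); apply/doteqP.
exists (\det open_matrix), (\det open_matrix); split; first exact: det_open_matrix.
by rewrite mulrA det_open_matrix mul1r.
Qed.

End BraidMatrix.

(** * Numberings, periodicity and connectedness of closures of powers *)

Section Closures.
Variable k : nat.
Implicit Types w : vbraid k.
Local Arguments cb_step : simpl never.

Lemma cb_step_level w (s : 'I_(size w).+1) j g : onth w s = Some g ->
  ((cb_step (s, j)).1 = s.+1 :> nat)%N /\ (cb_step (s, j)).2 = letter_perm g j.
Proof.
move=> w_s; rewrite /cb_step /level_perm /= w_s modn_small // ltnS.
by rewrite -onthTE w_s.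
Qed.

Lemma cb_step_last w (s : 'I_(size w).+1) j : onth w s = None ->
  s = size w :> nat /\ cb_step (s, j) = (ord0, j).
Proof.
move=> w_s; have s_L : s = size w :> nat.
  by apply/eqP; rewrite eqn_leq -ltnS ltn_ord -onthNE w_s.
split=> //; rewrite /cb_step /level_perm /= w_s perm1.
by congr (_, _); apply: val_inj; rewrite /= s_L modnn.
Qed.

(** What an Alexander numbering says about the numbers [x] above and [y] below
    a letter. *)
Definition letter_numbering (g : letter k) (x y : 'I_k -> int) : Prop :=
  if g.1 is Some _ then y =1 x /\ x (rpos g.2) = x (lpos g.2) + 1
  else forall j, y (letter_perm g j) = x j.

(** Levels are natural numbers here, so that the same [a], read modulo [size w], also numbers the
    powers of [w]. *)
Definition level_numbering w (a : nat -> 'I_k -> int) : Prop :=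
  (forall s g, onth w s = Some g -> letter_numbering g (a s) (a s.+1))
  /\ a (size w) =1 a 0%N.

Lemma codom_under_in w (s : 'I_(size w).+1) j g : onth w s = Some g ->
  ((s, j) \in codom (@cb_under_in k w))
  = if g.1 is Some b then j == under_pos b g.2 else false.
Proof.
case: g => [[b|] i] w_s /=.
  have [c c_E] := crossing_of_letter w_s.
  apply/codomP/eqP => [[d d_E]|->]; last first.
    by exists c; rewrite /cb_under_in /cb_positive c_E.
  have d_c : d = c by apply: cb_crossing_inj; have /= <- := congr1 fst d_E; rewrite c_E.
  by have -> : j = (cb_under_in d).2 := congr1 snd d_E;
    rewrite d_c /cb_under_in /cb_positive c_E.
by apply/negP => /codomP[d /(congr1 fst)/esym/level_crossing]; rewrite w_s.
Qed.

Lemma codom_over_in w (s : 'I_(size w).+1) j g : onth w s = Some g ->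
  ((s, j) \in codom (@cb_over_in k w))
  = if g.1 is Some b then j == over_pos b g.2 else false.
Proof.
case: g => [[b|] i] w_s /=.
  have [c c_E] := crossing_of_letter w_s.
  apply/codomP/eqP => [[d d_E]|->]; last first.
    by exists c; rewrite /cb_over_in /cb_positive c_E.
  have d_c : d = c by apply: cb_crossing_inj; have /= <- := congr1 fst d_E; rewrite c_E.
  by have -> : j = (cb_over_in d).2 := congr1 snd d_E;
    rewrite d_c /cb_over_in /cb_positive c_E.
by apply/negP => /codomP[d /(congr1 fst)/esym/level_crossing]; rewrite w_s.
Qed.

Lemma closure_numberingP w (a : nat -> 'I_k -> int) :
  @alexander_numbering (cb_diagram w) (fun e : cb_edge w => a e.1 e.2)
  <-> level_numbering w a.
Proof.
have step_a (s : 'I_(size w).+1) j g : onth w s = Some g ->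
    a (cb_step (s, j)).1 (cb_step (s, j)).2 = a s.+1 (letter_perm g j).
  by move=> /cb_step_level-/(_ j)[-> ->].
have permL (x : option bool) i : letter_perm (x, i) (lpos i) = rpos i.
  by rewrite /letter_perm tpermL.
have permR (x : option bool) i : letter_perm (x, i) (rpos i) = lpos i.
  by rewrite /letter_perm tpermR.
split=> [[plain cross]|[inner last]]; split.
- move=> s g w_s; have s_lt : (s < (size w).+1)%N.
    by rewrite ltnW // ltnS -onthTE w_s.
  pose s' := Ordinal s_lt; have w_s' : onth w s' = Some g by [].
  have aS j := step_a s' j g w_s'.
  have plain_s j := plain (s', j).
  case: g w_s w_s' aS => [[b|] i] w_s w_s' aS; rewrite /letter_numbering /=; last first.
    by move=> j; rewrite -aS plain_s // ?(codom_over_in j w_s') ?(codom_under_in j w_s').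
  have [c c_E] := crossing_of_letter w_s'.
  have [aR aL' aR'] : [/\ a s (rpos i) = a s (lpos i) + 1,
      a s.+1 (lpos i) = a s (lpos i) & a s.+1 (rpos i) = a s (rpos i)].
    have [l] := cross c; have := aS (rpos i); have := aS (lpos i); rewrite permL permR.
    have -> : @positive (cb_diagram w) c = b by rewrite /= /cb_positive c_E.
    have -> : @under_in (cb_diagram w) c = (s', under_pos b i).
      by rewrite /= /cb_under_in /cb_positive c_E.
    have -> : @over_in (cb_diagram w) c = (s', over_pos b i).
      by rewrite /= /cb_over_in /cb_positive c_E.
    by case: (b) => /= <- <- [-> -> -> ->].
  (* Strands away from the letter pass neither over nor under, so they keep their number. *)
  split=> // j; have [->//|jL] := eqVneq j (lpos i).
  have [->//|jR] := eqVneq j (rpos i).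
  have := aS j; rewrite /letter_perm tpermD 1?eq_sym // => <-.
  apply: plain_s; rewrite ?(codom_over_in j w_s') ?(codom_under_in j w_s') /=.
    by case: (b).
  by case: (b).
- move=> j; have w_L : onth w (@ord_max (size w)) = None by rewrite onth_default.
  have [_ E] := @cb_step_last w ord_max j w_L; have := plain (ord_max, j).
  by rewrite [step _]E /= => -> //; apply/negP => /codomP[d /(congr1 fst)/esym];
    move=> /level_crossing; rewrite w_L.
- move=> [s j]; case w_s: (onth w s) => [g|]; last first.
    by have [E1 E] := cb_step_last j w_s; rewrite [step _]E /= E1 last.
  rewrite (codom_over_in j w_s) (codom_under_in j w_s) (step_a _ _ _ w_s).
  have := inner s g w_s; case: g w_s => [[b|] i] w_s; rewrite /letter_numbering /=; last first.
    by move=> num _ _; rewrite num.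
  move=> [aS _] not_over not_under; rewrite aS /letter_perm tpermD // eq_sym.
    by case: (b) not_over not_under.
  by case: (b) not_over not_under.
move=> c; have w_s := level_crossing (erefl (val c).1.1).
have [aS aR] := inner _ _ w_s; exists (a (val c).1.1 (lpos (val c).2)).
rewrite /= /cb_over_in /cb_under_in !(step_a _ _ _ w_s) /= !aS.
by rewrite /cb_positive; case: ((sval c).1.2); rewrite permL permR; split.
Qed.

Lemma onth_vbraid_pow w q m g :
  onth (vbraid_pow w q) m = Some g -> onth w (m %% size w) = Some g.
Proof.
elim: q m => [|q IHq] m; first by rewrite onth0n.
rewrite /vbraid_pow /= onth_cat; case: ltnP => [lt_m|le_m].
  by rewrite modn_small.
by move=> /IHq; rewrite -[in X in _ -> X](subnK le_m) modnDr.
Qed.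

Lemma size_vbraid_pow w q : size (vbraid_pow w q) = (q * size w)%N.
Proof. by rewrite size_flatten /shape map_nseq sumn_nseq mulnC. Qed.

Lemma vbraid_powS w q : vbraid_pow w q.+1 = w ++ vbraid_pow w q.
Proof. by []. Qed.

Lemma vbraid_powSr w q : vbraid_pow w q.+1 = vbraid_pow w q ++ w.
Proof.
elim: q => [|q IHq]; first by rewrite vbraid_powS cats0.
by rewrite vbraid_powS {1}IHq catA.
Qed.

Lemma vbraid_pow_periodic w q : (0 < q)%N -> periodic q (Closure (vbraid_pow w q)).
Proof.
case: q => // q _; rewrite /periodic /= size_vbraid_pow dvdn_mulr // mulKn //.
by split; rewrite // {1}vbraid_powS rot_size_cat vbraid_powSr.
Qed.

Lemma quotient_vbraid_pow w q : (0 < q)%N ->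
  quotient_diagram q (Closure (vbraid_pow w q)) = Closure w.
Proof.
case: q => // q _; rewrite /quotient_diagram /= size_vbraid_pow mulKn //.
by rewrite vbraid_powS take_size_cat.
Qed.

Lemma level_numbering_pow w a q :
  level_numbering w a -> level_numbering (vbraid_pow w q) (fun s => a (s %% size w)%N).
Proof.
move=> [inner last]; split=> [s g /onth_vbraid_pow w_s|j]; last first.
  by rewrite size_vbraid_pow modnMl mod0n.
have := inner _ _ w_s; have : (s %% size w < size w)%N by rewrite -onthTE w_s.
move=> lt_s; suff -> : a (s.+1 %% size w)%N = a (s %% size w).+1 by [].
have -> : (s.+1 %% size w = (s %% size w).+1 %% size w)%N by rewrite -addn1 -modnDml addn1.
(* At the end of a copy of [w] the level jumps from [size w] to 0, where the numbers agree by
   [last]. *)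
move: lt_s; rewrite leq_eqVlt => /orP[/eqP E|lt_s]; last by rewrite modn_small.
by rewrite E modnn; apply/funext => j; rewrite last.
Qed.

(** Reducing levels modulo [size w] maps each step of the big closure to a path of at most two steps
    in the closure of [w], and every edge of the latter leads into the image. *)
Lemma knot_quotient w q : (0 < q)%N ->
  is_knot (cb_diagram (vbraid_pow w q)) -> is_knot (cb_diagram w).
Proof.
move=> q_gt0; set K := cb_diagram (vbraid_pow w q); set Kq := cb_diagram w.
case=> /card_gt0P[e0 _] K_conn; have k_gt0 : (0 < k)%N.
  exact: leq_ltn_trans (leq0n _) (ltn_ord e0.2).
split; first by rewrite card_prod !card_ord muln_gt0 k_gt0.
pose phi (e : edge K) : edge Kq := (inord (e.1 %% size w), e.2).
have phi_step e : fconnect (@step Kq) (phi e) (phi (step e)).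
  case: e => m j; case w_m: (onth (vbraid_pow w q) m) => [g|]; last first.
    (* The bottom level and level 0 have the same image: no step at all. *)
    have [m_L E] := cb_step_last j w_m; rewrite [step _]E /phi /= m_L.
    by rewrite size_vbraid_pow modnMl mod0n.
  have w_s := onth_vbraid_pow w_m; have [E1 E2] := cb_step_level j w_m.
  have lt_s : (m %% size w < size w)%N by rewrite -onthTE w_s.
  set s : 'I_(size w).+1 := inord (m %% size w).
  have s_E : s = (m %% size w)%N :> nat by rewrite inordK // ltnW.
  rewrite -s_E in w_s; have [F1 F2] := cb_step_level j w_s.
  have phi_E : phi (@step K (m, j)) = (inord (m.+1 %% size w), letter_perm g j).
    by rewrite -E1 -E2.
  have mS : (m.+1 %% size w = (m %% size w).+1 %% size w)%N by rewrite -addn1 -modnDml addn1.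
  have -> : phi (m, j) = (s, j) by [].
  move: lt_s; rewrite leq_eqVlt => /orP[/eqP s_L|lt_s].
    (* After the last letter of a copy, the closure of [w] also passes through its bottom level
       [size w]: two steps. *)
    have : cb_step (cb_step (s, j)) = phi (@step K (m, j)).
      rewrite [cb_step (s, j)]surjective_pairing F2.
      have [|_ ->] := @cb_step_last w (cb_step (s, j)).1 (letter_perm g j).
        by rewrite onth_default // F1 s_E s_L.
      rewrite phi_E mS s_L modnn; congr (_, _); apply: val_inj.
      by rewrite /= inordK.
    by move=> <-; apply: (fconnect_iter (@step Kq) 2).
  suff <- : @step Kq (s, j) = phi (@step K (m, j)) by apply: fconnect1.
  rewrite phi_E mS modn_small // [LHS](surjective_pairing (cb_step _)) F2.
  by congr (_, _); apply: val_inj; rewrite [LHS]F1 /= inordK ?s_E // ltnS ltnW.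
have phi_conn e e' : fconnect (@step Kq) (phi e) (phi e').
  have <- := iter_findex (K_conn e e'); elim: (findex _ _ _) => [|m IHm] //.
  exact: connect_trans IHm (phi_step _).
have phi_reach e : exists e', fconnect (@step Kq) e (phi e').
  case: e => s j; have [lt_s|le_s] := ltnP s (size w); last first.
    exists (ord0, j); have [|_ E] := @cb_step_last w s j; first by rewrite onth_default.
    have -> : phi (ord0, j) = @step Kq (s, j).
      by rewrite [step _]E; congr (_, _); apply: val_inj; rewrite /= mod0n inordK.
    exact: fconnect1.
  have s_K : (s < (size (vbraid_pow w q)).+1)%N.
    by rewrite ltnS size_vbraid_pow (leq_trans (ltnW lt_s)) // leq_pmull.
  exists (Ordinal s_K, j); have -> : phi (Ordinal s_K, j) = (s, j) => //.
  by congr (_, _); apply: val_inj; rewrite /= modn_small // inordK.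
move=> e e'; have [[x e_x] [x' e'_x']] := (phi_reach e, phi_reach e').
apply: connect_trans e_x (connect_trans (phi_conn x x') _).
by rewrite (fconnect_sym (@step_inj Kq)).
Qed.

End Closures.

Theorem theorem1p7 (p r k : nat) (hp : prime p) (hr : (1 <= r)%N)
    (beta : vbraid k) (lam : 'I_(size beta).+1 -> 'I_k -> int)
    (hlam : braid_numbering lam)
    (hK : is_knot (Closure (vbraid_pow beta (p ^ r)))) :
  let q := (p ^ r)%N in
  let K := Closure (vbraid_pow beta q) in
  let Kq := quotient_diagram q K in
  let f : laurent := \sum_(i < k) tpow (lam ord0 i) in
  [/\ periodic q K /\ almost_classical K,
      Kq = Closure beta,
      is_knot Kq /\ almost_classical Kq
    & forall DK DKq : laurent,
        is_alexander_polynomial K DK -> is_alexander_polynomial Kq DKq ->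
        ldvd DKq DK /\ doteq_mod p DK (DKq ^+ q * f ^+ q.-1)].
Proof.
move=> q K Kq f; have q_gt0 : (0 < q)%N by rewrite expn_gt0 prime_gt0.
have Kq_E : Kq = Closure beta by apply: quotient_vbraid_pow.
have k_gt0 : (0 < k)%N.
  have [/card_gt0P[e0 _] _] := hK.
  exact: leq_ltn_trans (leq0n _) (ltn_ord e0.2).
have knot_q : is_knot (Closure beta) by apply: knot_quotient hK.
(* [inord] is faithful on the levels up to [size beta], the only ones a numbering of [beta] refers
   to. *)
pose a s := lam (inord s).
have num_beta : level_numbering beta a.
  apply/closure_numberingP; congr (alexander_numbering _): hlam.
  by apply/funext => e; rewrite /a inord_val.
have /closure_numberingP num_K := level_numbering_pow q num_beta.
split=> //; first by split; [apply: vbraid_pow_periodic | eexists; exact: num_K].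
  by rewrite Kq_E; split=> //; eexists; exact: hlam.
rewrite Kq_E => DK DKq DK_poly DKq_poly.
have [c' [adjBq /(_ _ DK_poly) DK_c']] := closure_alexander_polynomial k_gt0 num_K hK.
have [c [adjB /(_ _ DKq_poly) DKq_c]] := closure_alexander_polynomial k_gt0 hlam knot_q.
pose w : 'rV[laurent]_k := \row_j tpow (lam ord0 j).
have wv : w 0 (Ordinal k_gt0) * tpow (- lam ord0 (Ordinal k_gt0)) = 1.
  by rewrite mxE tpowNK.
(* Both closures have the same numbers at the top, hence the same weight vector [w]. *)
have w_E : \row_j tpow (a (0 %% size beta)%N j) = w.
  apply/rowP => j; rewrite !mxE /a mod0n; congr (tpow (lam _ _)).
  by apply: val_inj; rewrite /= inordK.
rewrite w_E braid_matrix_pow in adjBq.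
have [[d c'_c] [z c'_mod]] := adj_power_sub1 hp wv adjB adjBq.
have f_E : \sum_i w 0 i = f by apply: eq_bigr => i _; rewrite mxE.
rewrite f_E in c'_mod.
have /doteqP[u [u' [uu' DK_E]]] := DK_c'.
have /doteqP[v [v' [vv' c_E]]] := doteq_sym DKq_c.
split; first by exists (u * d * v); rewrite DK_E c'_c c_E; ring.
(* From [DK = u * c'] and [c = v * DKq], the unit in the congruence is [u * v ^+ q], which
   [laurent_unit] writes as a signed power of [t]. *)
have : (u * v ^+ q) * (u' * v' ^+ q) = 1.
  by rewrite mulrACA uu' mul1r -exprMn vv' expr1n.
move=> /laurent_unit[e [m unit_E]]; exists e, m, (u * z).
by rewrite -unit_E DK_E c'_mod c_E exprMn; ring.
Qed.
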